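(* Let $\rho$ be a quantum state on a complex Hilbert space $\mathcal{H}_A$ of finite dimension $d$, let $\{|u_k\rangle\}_{k=1}^d$ be an orthonormal basis of eigenvectors of $\rho$, and let $\{|m_i\rangle\}_{i=1}^d$ be an orthonormal basis of $\mathcal{H}_A$ that is unbiased with respect to it, i.e. $|\langle m_i|u_k\rangle|=\frac{1}{\sqrt d}$ for all $i,k$. Then the projective measurement $\mathcal{M}=\{|m_i\rangle\langle m_i|\}_{i=1}^d$ simultaneously maximises, among all projective measurements on $\mathcal{H}_A$, the conditional min-entropy, the conditional von Neumann entropy and the conditional max-entropy of the outcome $X$ given the purifying system $E$; the values attained are $$H_{\min}(X|E)=-\log_2\Big(\tfrac1d(\operatorname{tr}\sqrt\rho)^2\Big),\qquad H(X|E)=\log_2d-S(\rho),\qquad H_{\max}(X|E)=\log_2 d+\log_2\lambda_{\max}(\rho),$$ where $S(\rho)=-\operatorname{tr}(\rho\log_2\rho)$ and $\lambda_{\max}(\rho)$ is the largest eigenvalue of $\rho$.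
   Context: A quantum state on a finite-dimensional Hilbert space is a positive semidefinite operator of trace one. A projective measurement on $\mathcal{H}_A$ is a finite family $\mathcal{M}=\{M_x\}_x$ of positive semidefinite operators with $M_xM_{x'}=\delta_{xx'}M_x$ and $\sum_xM_x=\mathbb{1}$ (projectors of any rank). Let $|\Psi\rangle_{AE}\in\mathcal{H}_A\otimes\mathcal{H}_E$ be a purification of $\rho$, i.e. a unit vector with $\operatorname{tr}_E|\Psi\rangle\langle\Psi|=\rho$. Measuring $\mathcal{M}$ on $A$ gives outcome $x$ with probability $p_x=\operatorname{tr}(M_x\rho)$ and leaves $E$ in the state $\rho_E^x=\frac1{p_x}\operatorname{tr}_A[(M_x\otimes\mathbb{1}_E)|\Psi\rangle\langle\Psi|]$ (outcomes with $p_x=0$ are omitted); set $\rho_{XE}=\sum_xp_x|x\rangle\langle x|\otimes\rho_E^x$ with $\{|x\rangle\}$ orthonormal and $\rho_E=\operatorname{tr}_X\rho_{XE}$. Conditional min-entropy: $H_{\min}(X|E)=-\log_2P_{\mathrm{guess}}(\rho,\mathcal{M})$, where $P_{\mathrm{guess}}(\rho,\mathcal{M})=\max\sum_x\operatorname{tr}(M_x\rho_x)$ over families $\rho_x\ge0$ of operators on $\mathcal{H}_A$ with $\sum_x\rho_x=\rho$. Conditional von Neumann entropy: $H(X|E)=S(\rho_{XE})-S(\rho_E)$, with $S(\sigma)=-\operatorname{tr}(\sigma\log_2\sigma)$ and $0\log_20=0$. Conditional max-entropy: $H_{\max}(X|E)=\log_2\max_\sigma\big(\sum_x\sqrt{p_x}\,F(\rho_E^x,\sigma)\big)^2$,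 the maximum being over quantum states $\sigma$ on $\mathcal{H}_E$, with $F(\tau,\sigma)=\operatorname{tr}\sqrt{\sqrt\sigma\,\tau\,\sqrt\sigma}$. *)

(* Defs.v *)
From mathcomp Require Import all_boot all_order all_algebra.
From mathcomp Require Import complex mxtens.
From mathcomp Require Import all_classical all_reals all_analysis.

Set Implicit Arguments.
Unset Strict Implicit.
Unset Printing Implicit Defensive.

Import Order.TTheory GRing.Theory Num.Theory.

Local Open Scope classical_set_scope.
Local Open Scope complex_scope.
Local Open Scope sesquilinear_scope.
Local Open Scope ring_scope.

(* Conventions. The d-dimensional complex Hilbert space is C^d, with vectors
   in 'cV[R[i]]_d; A ^t* (spectral.v) is the conjugate transpose, so that the
   inner product is antilinear in its first argument.  H_A (x) H_E is C^(d * e)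
   with the index convention of the Kronecker product *t of mxtens.v. *)

Section QuantumEntropies.
Variable R : realType.
Local Notation C := R[i].

(* ln x = 0 for x <= 0 in the library, hence log2 0 = 0. *)
Definition log2 (x : R) : R := ln x / ln 2.

Definition inner d (v w : 'cV[C]_d) : C := (v ^t* *m w) 0 0.

Definition ketbra d (v : 'cV[C]_d) : 'M[C]_d := v *m v ^t*.

(* The order of R[i] only compares numbers with the same imaginary part:
   0 <= z states that z is real and nonnegative. *)
Definition psd d (A : 'M[C]_d) : Prop :=
  forall v : 'cV[C]_d, 0 <= inner v (A *m v).

Definition quantum_state d (A : 'M[C]_d) : Prop := psd A /\ \tr A = 1.

(* d orthonormal vectors of C^d form a basis. *)
Definition orthonormal_basis d (b : 'I_d -> 'cV[C]_d) : Prop :=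
  forall i j, inner (b i) (b j) = (i == j)%:R.

(* f(A) for Hermitian A, which is P^-1 *m diag_mx D *m P with P unitary and D
   real, where P = spectralmx A and D = spectral_diag A. *)
Definition mxfun d (f : R -> R) (A : 'M[C]_d) : 'M[C]_d :=
  invmx (spectralmx A)
    *m diag_mx (map_mx (fun z : C => (f (complex.Re z))%:C) (spectral_diag A))
    *m spectralmx A.

Definition mxsqrt d (A : 'M[C]_d) : 'M[C]_d := mxfun Num.sqrt A.

(* Only applied to matrices whose trace is real. *)
Definition retr d (A : 'M[C]_d) : R := complex.Re (\tr A).

Definition vn_entropy d (A : 'M[C]_d) : R := - retr (A *m mxfun log2 A).

Definition fidelity d (A B : 'M[C]_d) : R :=
  retr (mxsqrt (mxsqrt B *m A *m mxsqrt B)).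

(* The set is finite, and nonempty for A Hermitian and d > 0. *)
Definition lambda_max d (A : 'M[C]_d) : R :=
  sup [set r : R | eigenvalue A r%:C].

Definition ptrace_l m n (A : 'M[C]_(m * n)) : 'M[C]_n :=
  \matrix_(i, j) \sum_(k < m) A (mxtens_index (k, i)) (mxtens_index (k, j)).

Definition ptrace_r m n (A : 'M[C]_(m * n)) : 'M[C]_m :=
  \matrix_(i, j) \sum_(k < n) A (mxtens_index (i, k)) (mxtens_index (j, k)).

Definition purification d e (rho : 'M[C]_d) (Psi : 'cV[C]_(d * e)) : Prop :=
  inner Psi Psi = 1 /\ ptrace_r (ketbra Psi) = rho.

Definition projective_measurement d n (M : 'I_n -> 'M[C]_d) : Prop :=
  [/\ forall x, psd (M x),
      forall x y, M x *m M y = (x == y)%:R *: M x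
    & \sum_x M x = 1%:M].

Definition basis_measurement d (b : 'I_d -> 'cV[C]_d) : 'I_d -> 'M[C]_d :=
  fun i => ketbra (b i).

Section Measurement.
Variables (d n e : nat).
Variables (rho : 'M[C]_d) (M : 'I_n -> 'M[C]_d) (Psi : 'cV[C]_(d * e)).

Definition outcome_prob (x : 'I_n) : R := retr (M x *m rho).

Definition post_state (x : 'I_n) : 'M[C]_e :=
  ((outcome_prob x)^-1)%:C *:
    ptrace_l (tensmx (M x) (1%:M : 'M[C]_e) *m ketbra Psi).

Definition cq_state : 'M[C]_(n * e) :=
  \sum_(x | outcome_prob x != 0)
    (outcome_prob x)%:C *: tensmx (delta_mx x x : 'M[C]_n) (post_state x).

(* For d > 0, rho a state and Psi a purification of rho, the maxima defining
   Pguess (M a projective measurement) and Hmax are taken over nonempty compact sets,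
   and the maximised functions are continuous, so that the suprema below are
   attained. *)
Definition Pguess : R :=
  sup [set r : R | exists s : 'I_n -> 'M[C]_d,
    [/\ forall x, psd (s x), \sum_x s x = rho
      & r = \sum_x retr (M x *m s x)]].

Definition Hmin : R := - log2 Pguess.

Definition HvN : R := vn_entropy cq_state - vn_entropy (ptrace_l cq_state).

Definition Hmax : R :=
  log2 (sup [set r : R | exists2 sigma : 'M[C]_e, quantum_state sigma
    & r = (\sum_(x | outcome_prob x != 0)
             Num.sqrt (outcome_prob x) * fidelity (post_state x) sigma) ^+ 2]).

End Measurement.

End QuantumEntropies.

(* Main.v *)
Require Import Defs.
From mathcomp Require Import all_boot all_order all_algebra.
From mathcomp Require Import complex mxtens.
From mathcomp Require Import all_classical all_reals all_analysis.
From mathcomp Require Import ring lra.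

(** Reshape Psi into a matrix G from C^d to C^e, so that G^* G = rho^T and the
    unnormalised state of E after outcome x is G M_x^T G^*.  As X X^* and X^* X
    have the same power traces, the spectral functionals of E reduce to those of
    pinchings D(w) = sum_x M_x^T w M_x^T on C^d:
      H(X|E) = S(D(rho^T)) - S(rho),
      sum_x sqrt(p_x) F(rho_E^x, sigma) = tr sqrt(D(G^* sigma G)).
    Concavity bounds these by log2 d - S(rho) and by
    sqrt(d tr(sigma rho_E)) <= sqrt(d lambda_max).  Both bounds are attained in
    an unbiased basis, because there D(w) is a multiple of the identity for
    every w diagonal in the conjugate eigenbasis.  The guessing probability is always
    at least tr(D(sqrt rho)^2) >= (tr sqrt rho)^2 / d, by the decomposition
    rho_x = sqrt rho M_x sqrt rho, and Minkowski's inequality gives the converse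
    bound for an unbiased basis. *)

Set Implicit Arguments.
Unset Strict Implicit.
Unset Printing Implicit Defensive.

Import Order.TTheory GRing.Theory Num.Theory.

Local Open Scope complex_scope.
Local Open Scope sesquilinear_scope.
Local Open Scope ring_scope.

(** * Recovering spectral sums from power sums *)

Section PowerSums.
Variable F : fieldType.

Lemma interpolating_poly (g : F -> F) (s : seq F) :
  exists p : {poly F}, {in s, forall x, p.[x] = g x}.
Proof.
elim: s => [|a s [p pP]]; first by exists 0.
have [as_|nas] := boolP (a \in s).
  by exists p => x; rewrite inE => /predU1P[->|]; exact: pP.
(* [q] vanishes on [s] but not at [a], so a multiple of it corrects the value at [a] alone. *)
pose q := \prod_(b <- s) ('X - b%:P).
have qa : q.[a] != 0 by rewrite -rootE root_prod_XsubC.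
exists (p + ((g a - p.[a]) / q.[a]) *: q) => x.
rewrite inE !hornerE; have [->|xa] /= := eqVneq x a.
  by move=> _; rewrite divfK // addrC subrK.
move=> xs; have /eqP -> : q.[x] == 0 by rewrite -rootE root_prod_XsubC.
by rewrite mulr0 addr0 pP.
Qed.

(* Only positive powers are compared, so the two families may differ by zeros:
   this is what allows comparing matrices of different sizes. *)
Lemma eq_sum_of_eq_power_sums (I J : finType) (a : I -> F) (b : J -> F)
    (g : F -> F) :
    g 0 = 0 ->
    (forall k, \sum_i a i ^+ k.+1 = \sum_j b j ^+ k.+1) ->
  \sum_i g (a i) = \sum_j g (b j).
Proof.
move=> g0 ab.
(* With 0 among the nodes, [p] has zero constant term, so only positive power sums enter. *)
have [p pP] := interpolating_poly g
  (0 :: [seq a i | i <- enum I] ++ [seq b j | j <- enum J]).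
have p0 : p`_0 = 0 by rewrite -horner_coef0 pP ?g0 // inE eqxx.
have E (K : finType) (c : K -> F) : (forall i, p.[c i] = g (c i)) ->
    \sum_i g (c i) = \sum_(k < size p) p`_k * \sum_i c i ^+ k.
  move=> cP; under eq_bigr do rewrite -cP horner_coef.
  by rewrite exchange_big; apply: eq_bigr => k _; rewrite mulr_sumr.
rewrite (E _ a) ?(E _ b).
- by apply: eq_bigr => -[[|k] ?] _ /=; rewrite ?p0 ?mul0r ?ab.
- by move=> j; rewrite pP // inE mem_cat map_f ?orbT // mem_enum.
- by move=> i; rewrite pP // inE mem_cat map_f ?orbT // mem_enum.
Qed.

End PowerSums.

(** * Inequalities for finite real sums and logarithms *)

Section RealInequalities.
Variable R : realType.

(** Cauchy-Schwarz by Lagrange's identity: the double sum of squares is twice the gap between the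
    two sides. *)
Lemma sqr_sum_le (I : finType) (a b : I -> R) :
  (\sum_i a i * b i) ^+ 2 <= (\sum_i a i ^+ 2) * (\sum_i b i ^+ 2).
Proof.
have : 0 <= \sum_i \sum_j (a i * b j - a j * b i) ^+ 2.
  by do 2![apply: sumr_ge0 => ? _]; exact: sqr_ge0.
have -> : \sum_i \sum_j (a i * b j - a j * b i) ^+ 2 =
    2 * ((\sum_i a i ^+ 2) * (\sum_i b i ^+ 2) - (\sum_i a i * b i) ^+ 2).
  transitivity (\sum_i \sum_j (a i ^+ 2 * b j ^+ 2) +
      \sum_i \sum_j (b i ^+ 2 * a j ^+ 2) -
      2 * \sum_i \sum_j (a i * b i) * (a j * b j)).
    rewrite mulr_sumr -big_split -sumrB; apply: eq_bigr => i _.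
    rewrite mulr_sumr -big_split -sumrB; apply: eq_bigr => j _ /=.
    by ring.
  by rewrite -!big_distrlr /=; ring.
by rewrite pmulr_rge0 // subr_ge0.
Qed.

Lemma sqr_sum_le_card (d : nat) (a : 'I_d -> R) :
  (\sum_i a i) ^+ 2 <= d%:R * \sum_i a i ^+ 2.
Proof.
have := sqr_sum_le (fun=> 1) a.
under eq_bigr do rewrite mul1r.
by under [X in _ <= X * _]eq_bigr do rewrite expr1n;
   rewrite big_const_ord iter_addr_0.
Qed.

(* Minkowski's inequality for the Euclidean norms of the vectors w(.,k). *)
Lemma sum_sqr_sum_le (I J : finType) (w : I -> J -> R) :
  \sum_i (\sum_j w i j) ^+ 2 <= (\sum_j Num.sqrt (\sum_i w i j ^+ 2)) ^+ 2.
Proof.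
under eq_bigr do rewrite expr2 big_distrlr /=.
(* Both squares become double sums over pairs of columns, compared pair by pair through
   Cauchy-Schwarz. *)
rewrite expr2 big_distrlr /= exchange_big; apply: ler_sum => j _.
rewrite exchange_big; apply: ler_sum => k _ /=.
apply: le_trans (ler_norm _) _; rewrite -sqrtr_sqr -sqrtrM.
  by rewrite ler_wsqrtr // sqr_sum_le.
by apply: sumr_ge0 => i _; exact: sqr_ge0.
Qed.

(** Gibbs' inequality against the uniform distribution: [ln t <= t - 1] at [t = 1 / (a i * d)]
    bounds each term from below by [a i - 1 / d], and these sum to zero. *)
Lemma sum_xlog2x_ge (d : nat) (a : 'I_d -> R) :
    (0 < d)%N -> (forall i, 0 <= a i) -> \sum_i a i = 1 ->
  - log2 d%:R <= \sum_i a i * log2 (a i).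
Proof.
move=> d0 a0 a1.
have d0' : (0 : R) < d%:R by rewrite ltr0n.
have ln2 : 0 < ln (2 : R) by rewrite ln_gt0 // ltr1n.
have K i : a i - d%:R^-1 <= a i * (ln (a i) + ln d%:R).
  have := a0 i; rewrite le_eqVlt => /predU1P[<-|ai].
    by rewrite sub0r mul0r oppr_le0 invr_ge0 ltW.
  have p : 0 < (a i * d%:R)^-1 by rewrite invr_gt0 mulr_gt0.
  have := le_ln1Dx (x := (a i * d%:R)^-1 - 1).
  rewrite [1 + _]addrC subrK lnV ?posrE ?mulr_gt0 // lnM ?posrE // => H.
  have {}H := H _.
  have {H} : - (ln (a i) + ln d%:R) <= (a i * d%:R)^-1 - 1.
    by apply: H; rewrite ltrBrDl subrr.
  move=> /(ler_wpM2l (a0 i)); rewrite mulrN mulrBr mulr1 invfM mulrA.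
  by rewrite divff ?mul1r ?gt_eqF // lerNl opprB.
have : 0 <= \sum_i a i * (ln (a i) + ln d%:R).
  apply: le_trans (ler_sum _ (fun i _ => K i)).
  rewrite sumrB a1 sumr_const card_ord -[X in _ - X]mulr_natr.
  by rewrite mulVf ?gt_eqF ?subrr.
under eq_bigr do rewrite mulrDr.
rewrite big_split -mulr_suml a1 mul1r /= => H.
rewrite /log2; under eq_bigr do rewrite mulrA.
rewrite -mulr_suml -mulNr ler_pM2r ?invr_gt0 //; lra.
Qed.

(** As [ln] is 0 on nonpositive reals, [1 <= y] covers these [x] too; this fits a supremum whose
    positivity is not established. *)
Lemma ler_log2_ge1 (x y : R) : x <= y -> 1 <= y -> log2 x <= log2 y.
Proof.
move=> xy y1; have ln2 : 0 < ln (2 : R) by rewrite ln_gt0 // ltr1n.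
rewrite /log2 ler_pM2r ?invr_gt0 //; have [x0|x0] := leP x 0.
  by rewrite ln0 // ln_ge0.
by rewrite ler_ln ?posrE // (lt_le_trans x0).
Qed.

Lemma log2M (x y : R) : 0 < x -> 0 < y -> log2 (x * y) = log2 x + log2 y.
Proof. by move=> x0 y0; rewrite /log2 lnM ?posrE // mulrDl. Qed.

Lemma ler_log2 (x y : R) : 0 < x -> x <= y -> log2 x <= log2 y.
Proof.
move=> x0 xy; have ln2 : 0 < ln (2 : R) by rewrite ln_gt0 // ltr1n.
by rewrite /log2 ler_pM2r ?invr_gt0 // ler_ln ?posrE // (lt_le_trans x0).
Qed.

End RealInequalities.

(** * Matrices over a closed field *)

Section ClosedFieldMatrices.
Variable C : numClosedFieldType.

Lemma adjmxM m n p (A : 'M[C]_(m, n)) (B : 'M[C]_(n, p)) :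
  (A *m B)^t* = B^t* *m A^t*.
Proof. by rewrite trmx_mul map_mxM. Qed.

Lemma adjmx_sum (I : finType) m n (A : I -> 'M[C]_(m, n)) :
  (\sum_i A i)^t* = \sum_i (A i)^t*.
Proof. by rewrite linear_sum raddf_sum. Qed.

Lemma adjmxD m n (A B : 'M[C]_(m, n)) : (A + B)^t* = A^t* + B^t*.
Proof. by rewrite linearD map_mxD. Qed.

Lemma adjmxZ m n c (A : 'M[C]_(m, n)) : (c *: A)^t* = c^* *: A^t*.
Proof. by apply/matrixP => i j; rewrite !mxE rmorphM. Qed.

Lemma trace_adj_mul_ge0 m n (B : 'M[C]_(m, n)) : 0 <= \tr (B^t* *m B).
Proof.
apply: sumr_ge0 => i _; rewrite mxE; apply: sumr_ge0 => j _.
by rewrite !mxE mulrC mul_conjC_ge0.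
Qed.

Lemma trace_adj_mul_eq0 m n (B : 'M[C]_(m, n)) : \tr (B^t* *m B) = 0 -> B = 0.
Proof.
have E : \tr (B^t* *m B) = \sum_i \sum_j `|B j i| ^+ 2.
  by apply: eq_bigr => i _; rewrite mxE; apply: eq_bigr => j _;
     rewrite !mxE mulrC normCK.
rewrite E => H; apply/matrixP => j i; rewrite mxE.
have /psumr_eq0P H1 := H.
have {}H1 : \sum_j `|B j i| ^+ 2 = 0.
  by apply: H1 => // k _; apply: sumr_ge0 => ? _; exact: exprn_ge0.
have := psumr_eq0P _ H1 (i := j).
move=> /(_ (fun k _ => exprn_ge0 2 (normr_ge0 _)) isT) /eqP.
by rewrite sqrf_eq0 normr_eq0 => /eqP.
Qed.

Lemma entry_mulmx m n (A : 'M[C]_(m, n)) i j :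
  A i j = ((delta_mx i 0 : 'cV[C]_m)^t* *m (A *m (delta_mx j 0 : 'cV[C]_n))) 0 0.
Proof.
by rewrite -colE trmx_delta map_delta_mx -rowE !mxE.
Qed.

(** Polarisation: on [delta_mx i 0 + c *: delta_mx j 0] the form reduces to two off-diagonal terms,
    and [c = 1] with [c = 'i] makes both entries vanish. *)
Lemma quadratic_form_eq0 n (A : 'M[C]_n) :
  (forall v : 'cV[C]_n, (v^t* *m (A *m v)) 0 0 = 0) -> A = 0.
Proof.
move=> A0; apply/matrixP => i j; rewrite [RHS]mxE.
have D k : A k k = 0 by rewrite entry_mulmx; exact: A0.
have entryD (M N : 'M[C]_1) : (M + N) 0 0 = M 0 0 + N 0 0 by rewrite mxE.
have entryZ (c : C) (M : 'M[C]_1) : (c *: M) 0 0 = c * M 0 0 by rewrite mxE.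
have E (c : C) : c * A i j + c^* * A j i = 0.
  have := A0 (delta_mx i 0 + c *: delta_mx j 0).
  rewrite adjmxD adjmxZ !mulmxDr !mulmxDl -!scalemxAr -!scalemxAl.
  rewrite !entryD !entryZ -(entry_mulmx A i i) -(entry_mulmx A i j).
  rewrite -(entry_mulmx A j i) -(entry_mulmx A j j) !D !mulr0 add0r !addr0.
  by rewrite addrC.
have := E 1; have := E 'i.
rewrite conjCi conjC1 !mul1r mulNr -mulrBr => /eqP.
rewrite mulf_eq0 (negPf (neq0Ci _)) /= subr_eq0 => /eqP <- /eqP.
by rewrite -mulr2n mulrn_eq0 => /eqP.
Qed.

Lemma spectral_unitary n (A : 'M[C]_n) :
  spectralmx A *m (spectralmx A)^t* = 1%:M /\
  (spectralmx A)^t* *m spectralmx A = 1%:M.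
Proof.
have /unitarymxP H := spectral_unitarymx A; split=> //; exact: mulmx1C.
Qed.

Lemma diag_mx_exp n (D : 'rV[C]_n) k :
  diag_mx D ^+ k = diag_mx (\row_i D 0 i ^+ k).
Proof.
elim: k => [|k IH].
  by apply/matrixP => i j; rewrite expr0 -idmxE !mxE expr0.
rewrite exprS IH -mulmxE mulmx_diag; congr diag_mx.
by apply/rowP => i; rewrite !mxE exprS.
Qed.

Lemma adjmx_diag n (D : 'rV[C]_n) :
  (forall i, D 0 i \is Num.real) -> (diag_mx D)^t* = diag_mx D.
Proof.
move=> Dr; rewrite tr_diag_mx map_diag_mx; congr diag_mx.
by apply/rowP => i; rewrite mxE; exact: conj_Creal.
Qed.

Lemma conj_diag_mul n (P : 'M[C]_n) (D E : 'rV[C]_n) : P *m P^t* = 1%:M ->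
  (P^t* *m diag_mx D *m P) *m (P^t* *m diag_mx E *m P) =
  P^t* *m diag_mx (\row_i (D 0 i * E 0 i)) *m P.
Proof.
move=> PP; rewrite -mulmx_diag !mulmxA.
by rewrite -[_ *m P *m _]mulmxA PP mulmx1.
Qed.

Lemma scalemx_exp n c (A : 'M[C]_n) k : (c *: A) ^+ k = c ^+ k *: A ^+ k.
Proof.
elim: k => [|k IH]; first by rewrite !expr0 scale1r.
by rewrite !exprS IH -!mulmxE -scalemxAl -scalemxAr scalerA.
Qed.

(** Regroup [(A B)^(k+1)] as [A (B A)^k B] and use cyclicity. At exponent 0 the traces would be [m]
    and [n]. *)
Lemma trace_exp_mulC m n (A : 'M[C]_(m, n)) (B : 'M[C]_(n, m)) k :
  \tr ((A *m B) ^+ k.+1) = \tr ((B *m A) ^+ k.+1).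
Proof.
have E : (A *m B) ^+ k.+1 = A *m ((B *m A) ^+ k *m B).
  elim: k => [|k IH]; first by rewrite expr1 expr0 -idmxE mul1mx.
  by rewrite exprS IH [(B *m A) ^+ k.+1]exprS -!mulmxE !mulmxA.
by rewrite E mxtrace_mulC exprSr -mulmxE mulmxA.
Qed.

Lemma orthogonal_sum_exp (I : finType) n (A : I -> 'M[C]_n) k :
    (forall x y, x != y -> A x *m A y = 0) ->
  (\sum_x A x) ^+ k.+1 = \sum_x A x ^+ k.+1.
Proof.
move=> A0; elim: k => [|k IH]; first by rewrite expr1.
rewrite exprS IH mulr_suml; apply: eq_bigr => x _.
rewrite mulr_sumr (bigD1 x) //= -exprS big1 ?addr0 // => y yx.
by rewrite exprS mulrA -mulmxE A0 ?mul0mx // eq_sym.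
Qed.

Lemma hermitian_spectral n (A : 'M[C]_n) : A^t* = A ->
  A = (spectralmx A)^t* *m diag_mx (spectral_diag A) *m spectralmx A /\
  forall i, spectral_diag A 0 i \is Num.real.
Proof.
move=> Ah; have Ahs : A \is hermsymmx.
  by apply/is_hermitianmxP; rewrite expr0 scale1r Ah.
split; last first.
  by move=> i; have /mxOverP := hermitian_spectral_diag_real Ahs; exact.
have /orthomx_spectralP := hermitian_normalmx Ahs.
by rewrite invmx_unitary ?spectral_unitarymx.
Qed.

End ClosedFieldMatrices.

(** * Positive semidefinite matrices and spectral functionals *)

Section Matrices.
Variable R : realType.
Local Notation C := R[i].

Lemma conjC_real (x : R) : Num.conj (x%:C) = x%:C :> C.
Proof. exact: conjc_real. Qed.

Lemma psd_gram m n (B : 'M[C]_(m, n)) : psd (B^t* *m B).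
Proof.
move=> v; rewrite /inner mulmxA mulmxA -adjmxM -mulmxA -trace_mx11.
exact: trace_adj_mul_ge0.
Qed.

Lemma psd_congr m n (B : 'M[C]_(m, n)) (A : 'M[C]_m) :
  psd A -> psd (B^t* *m A *m B).
Proof. by move=> A0 v; have := A0 (B *m v); rewrite /inner adjmxM !mulmxA. Qed.

Lemma psd_diag n (A : 'M[C]_n) i : psd A -> 0 <= A i i.
Proof. by move=> A0; rewrite entry_mulmx; exact: A0. Qed.

Lemma psd_trace_ge0 n (A : 'M[C]_n) : psd A -> 0 <= \tr A.
Proof. by move=> A0; apply: sumr_ge0 => i _; exact: psd_diag. Qed.

(** Nonnegativity in the order of [R[i]] makes the quadratic form real, so the form of [A^t* - A]
    vanishes. *)
Lemma psd_adj n (A : 'M[C]_n) : psd A -> A^t* = A.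
Proof.
move=> A0; apply/eqP; rewrite -subr_eq0; apply/eqP/quadratic_form_eq0 => v.
rewrite /inner mulmxBl mulmxBr.
have -> : v^t* *m (A^t* *m v) = (v^t* *m (A *m v))^t*.
  by rewrite !adjmxM trmxCK mulmxA.
have : 0 <= (v^t* *m (A *m v)) 0 0 by exact: A0.
by move: (v^t* *m _) => X X0; rewrite !mxE conj_Creal ?subrr ?ger0_real.
Qed.

Lemma psd_sum (I : finType) n (A : I -> 'M[C]_n) :
  (forall i, psd (A i)) -> psd (\sum_i A i).
Proof.
move=> A0 v; rewrite /inner mulmx_suml mulmx_sumr summxE.
by apply: sumr_ge0 => i _; exact: A0.
Qed.

Definition eigs n (A : 'M[C]_n) (i : 'I_n) : R :=
  complex.Re (spectral_diag A 0 i).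

(** The trace of f(A) for Hermitian [A]. If [f 0 = 0], power traces determine it, even across
    different sizes. *)
Definition trfun n (f : R -> R) (A : 'M[C]_n) : R := \sum_i f (eigs A i).

Lemma spectral_decomposition n (A : 'M[C]_n) : A^t* = A ->
  A = (spectralmx A)^t* *m diag_mx (\row_i (eigs A i)%:C) *m spectralmx A.
Proof.
move=> /hermitian_spectral[AE Areal].
have -> : \row_i (eigs A i)%:C = spectral_diag A.
  by apply/rowP => i; rewrite mxE; apply: RRe_real; exact: Areal.
exact: AE.
Qed.

Lemma eigs_ge0 n (A : 'M[C]_n) i : psd A -> 0 <= eigs A i.
Proof.
move=> A0; have [PP _] := spectral_unitary A.
have := psd_diag i (psd_congr ((spectralmx A)^t*) A0).
rewrite trmxCK {2}(spectral_decomposition (psd_adj A0)) !mulmxA PP mul1mx.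
by rewrite -mulmxA PP mulmx1 !mxE eqxx mulr1n lecR.
Qed.

Lemma trace_exp n (A : 'M[C]_n) k : A^t* = A ->
  \tr (A ^+ k.+1) = (\sum_i eigs A i ^+ k.+1)%:C.
Proof.
move=> Ah; have [PP _] := spectral_unitary A.
rewrite {1}(spectral_decomposition Ah) -mulmxA trace_exp_mulC -mulmxA PP mulmx1.
rewrite diag_mx_exp mxtrace_diag rmorph_sum.
by apply: eq_bigr => i _; rewrite !mxE rmorphXn.
Qed.

Lemma sum_trfun (I : finType) m n (A : I -> 'M[C]_m) (B : 'M[C]_n)
    (g : R -> R) :
    g 0 = 0 -> (forall x, (A x)^t* = A x) -> B^t* = B ->
    (forall k, \sum_x \tr (A x ^+ k.+1) = \tr (B ^+ k.+1)) ->
  \sum_x trfun g (A x) = trfun g B.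
Proof.
move=> g0 Ah Bh AB; rewrite /trfun pair_bigA /=.
apply: (eq_sum_of_eq_power_sums (a := fun p => eigs (A p.1) p.2)) => // k.
rewrite -(pair_bigA _ (fun x i => eigs (A x) i ^+ k.+1)) /=.
apply: (@complexI R); rewrite -trace_exp // -AB rmorph_sum.
by apply: eq_bigr => x _; rewrite trace_exp.
Qed.

(** Working with power traces avoids matching a known spectrum with the eigenvectors chosen by
    [spectralmx]. *)
Lemma trfun_of_traces (I : finType) n (A : 'M[C]_n) (a : I -> R)
    (g : R -> R) :
    g 0 = 0 -> A^t* = A ->
    (forall k, \tr (A ^+ k.+1) = (\sum_i a i ^+ k.+1)%:C) ->
  trfun g A = \sum_i g (a i).
Proof.
move=> g0 Ah AB; apply: eq_sum_of_eq_power_sums => // k.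
by apply: (@complexI R); rewrite -trace_exp.
Qed.

Lemma eq_trfun m n (A : 'M[C]_m) (B : 'M[C]_n) (g : R -> R) :
    g 0 = 0 -> A^t* = A -> B^t* = B ->
    (forall k, \tr (A ^+ k.+1) = \tr (B ^+ k.+1)) ->
  trfun g A = trfun g B.
Proof.
by move=> g0 Ah Bh AB; apply: trfun_of_traces => // k; rewrite AB trace_exp.
Qed.

Lemma trfun_sqrtZ n (c : R) (A : 'M[C]_n) : 0 <= c -> A^t* = A ->
  trfun Num.sqrt (c%:C *: A) = Num.sqrt c * trfun Num.sqrt A.
Proof.
move=> c0 Ah; rewrite mulr_sumr; under [RHS]eq_bigr do rewrite -sqrtrM //.
apply: (trfun_of_traces (a := fun i => c * eigs A i)); rewrite ?sqrtr0 //.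
  by rewrite adjmxZ Ah conjC_real.
move=> k; rewrite scalemx_exp mxtraceZ trace_exp // -rmorphXn -rmorphM.
rewrite mulr_sumr.
by under [in RHS]eq_bigr do rewrite exprMn.
Qed.

Lemma trfun_scalar n (c : R) (g : R -> R) : g 0 = 0 ->
  trfun g ((c%:C)%:M : 'M[C]_n) = n%:R * g c.
Proof.
move=> g0; rewrite (trfun_of_traces (a := fun _ : 'I_n => c)) //.
- by rewrite sumr_const card_ord mulr_natl.
- by rewrite tr_scalar_mx map_scalar_mx; congr _%:M; exact: conjC_real.
move=> k; rewrite -diag_const_mx diag_mx_exp mxtrace_diag rmorph_sum.
by apply: eq_bigr => i _; rewrite !mxE rmorphXn.
Qed.

Lemma trfun_id n (A : 'M[C]_n) : A^t* = A -> trfun id A = retr A.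
Proof.
by move=> Ah; rewrite /retr -[A in RHS]expr1 trace_exp.
Qed.

Lemma mxfunE n f (A : 'M[C]_n) :
  mxfun f A =
  (spectralmx A)^t* *m diag_mx (\row_i (f (eigs A i))%:C) *m spectralmx A.
Proof.
rewrite /mxfun; have -> : map_mx (fun z : C => (f (complex.Re z))%:C)
    (spectral_diag A) = \row_i (f (eigs A i))%:C.
  by apply/rowP => i; rewrite !mxE.
by rewrite (invmx_unitary (spectral_unitarymx A)).
Qed.

Lemma retr_mxfun n f (A : 'M[C]_n) : retr (mxfun f A) = trfun f A.
Proof.
rewrite /retr /mxfun invmx_unitary ?spectral_unitarymx //.
have [PP _] := spectral_unitary A.
rewrite -mulmxA mxtrace_mulC -mulmxA PP mulmx1 mxtrace_diag raddf_sum.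
by apply: eq_bigr => i _; rewrite !mxE.
Qed.

Lemma vn_entropyE n (A : 'M[C]_n) : A^t* = A ->
  vn_entropy A = - trfun (fun t => t * log2 t) A.
Proof.
move=> Ah; rewrite /vn_entropy /retr /mxfun invmx_unitary ?spectral_unitarymx //.
have [PP _] := spectral_unitary A; congr (- _).
rewrite {1}(spectral_decomposition Ah) !mulmxA mxtrace_mulC !mulmxA PP mul1mx.
rewrite -[_ *m _ *m (_)^t*]mulmxA PP mulmx1 mulmx_diag mxtrace_diag raddf_sum.
by apply: eq_bigr => i _; rewrite !mxE -rmorphM.
Qed.

Lemma mxsqrt_adj n (A : 'M[C]_n) : (mxsqrt A)^t* = mxsqrt A.
Proof.
rewrite /mxsqrt /mxfun invmx_unitary ?spectral_unitarymx // !adjmxM trmxCK.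
rewrite mulmxA adjmx_diag // => i; rewrite mxE.
by apply/complex_realP; eexists.
Qed.

Lemma mxsqrt_sqr n (A : 'M[C]_n) : psd A -> mxsqrt A *m mxsqrt A = A.
Proof.
move=> A0; have [PP _] := spectral_unitary A.
rewrite {3}(spectral_decomposition (psd_adj A0)) /mxsqrt mxfunE.
apply: etrans (conj_diag_mul _ _ PP) _.
set D := (X in diag_mx X); set E := (X in _ = _ *m diag_mx X *m _).
suff -> : D = E by [].
apply/rowP => i; rewrite !mxE -rmorphM.
by rewrite -expr2 sqr_sqrtr ?eigs_ge0.
Qed.

End Matrices.

(** * Projective measurements and guessing *)

Section Measurements.
Variable R : realType.
Local Notation C := R[i].

Lemma inner_conj d (v w : 'cV[C]_d) : (inner v w)^* = inner w v.
Proof.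
rewrite /inner !mxE rmorph_sum; apply: eq_bigr => j _.
by rewrite !mxE rmorphM /= conjCK mulrC.
Qed.

Lemma ReM_real (z : C) (r : R) : complex.Re (z * r%:C) = complex.Re z * r.
Proof. by case: z => a b /=; rewrite mulr0 subr0. Qed.

Lemma sqr_retr_le n (A : 'M[C]_n) : A^t* = A ->
  retr A ^+ 2 <= n%:R * retr (A *m A).
Proof.
move=> Ah; have -> : retr (A *m A) = \sum_i eigs A i ^+ 2.
  by rewrite /retr -[A *m A]expr2 trace_exp.
by rewrite -trfun_id //; exact: sqr_sum_le_card.
Qed.

(** Cauchy-Schwarz on the square roots of the eigenvalues; this is the concavity bound behind the
    max-entropy. *)
Lemma sqr_trfun_sqrt_le n (A : 'M[C]_n) : psd A ->
  trfun Num.sqrt A ^+ 2 <= n%:R * retr A.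
Proof.
move=> A0; rewrite -(trfun_id (psd_adj A0)).
have -> : trfun id A = \sum_i Num.sqrt (eigs A i) ^+ 2.
  by apply: eq_bigr => i _; rewrite sqr_sqrtr ?eigs_ge0.
exact: sqr_sum_le_card.
Qed.

Lemma vn_entropy_le n (A : 'M[C]_n) : (0 < n)%N -> psd A -> retr A = 1 ->
  - trfun (fun t => t * log2 t) A <= log2 n%:R.
Proof.
move=> n0 A0 A1; rewrite lerNl; apply: sum_xlog2x_ge => //.
  by move=> i; exact: eigs_ge0.
by rewrite -A1 -trfun_id ?psd_adj.
Qed.

(** In an eigenbasis of [A] the eigenvalues are weighted by the diagonal entries of [S], which are
    nonnegative. *)
Lemma retr_mul_le n (l : R) (S A : 'M[C]_n) : psd S -> A^t* = A ->
  (forall i, eigs A i <= l) -> retr (S *m A) <= l * retr S.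
Proof.
move=> S0 Ah Al; have [PP PP'] := spectral_unitary A.
set P := spectralmx A in PP PP'; pose Q := P *m S *m P^t*.
have Q0 : psd Q by have := psd_congr (P^t*) S0; rewrite trmxCK.
have -> : retr S = \sum_i complex.Re (Q i i).
  rewrite -raddf_sum -/(\tr Q) /retr; congr complex.Re.
  by rewrite mxtrace_mulC mulmxA PP' mul1mx.
have -> : retr (S *m A) = \sum_i complex.Re (Q i i) * eigs A i.
  rewrite /retr {1}(spectral_decomposition Ah) -/P !mulmxA mxtrace_mulC !mulmxA.
  rewrite -/Q raddf_sum; apply: eq_bigr => i _.
  by rewrite mul_mx_diag !mxE; exact: ReM_real.
rewrite mulr_sumr; apply: ler_sum => i _; rewrite mulrC ler_wpM2r //.
by have := psd_diag i Q0; rewrite lecE => /andP[].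
Qed.

Lemma retr_sum (I : finType) n (A : I -> 'M[C]_n) :
  retr (\sum_i A i) = \sum_i retr (A i).
Proof.
have -> : retr (\sum_i A i) = complex.Re (\sum_i \tr (A i)).
  by congr complex.Re; rewrite raddf_sum.
by rewrite raddf_sum.
Qed.

Lemma retr_ge0 n (A : 'M[C]_n) : psd A -> 0 <= retr A.
Proof. by move=> /psd_trace_ge0; rewrite lecE => /andP[]. Qed.

Section Projections.
Variables (d n : nat) (M : 'I_n -> 'M[C]_d).
Hypothesis M_proj : projective_measurement M.

Lemma projector_adj x : (M x)^t* = M x.
Proof. by case: M_proj => M0 _ _; exact: psd_adj. Qed.

Lemma projector_idem x : M x *m M x = M x.
Proof. by case: M_proj => _ MM _; rewrite MM eqxx scale1r. Qed.

Lemma projector_orth x y : x != y -> M x *m M y = 0.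
Proof. by case: M_proj => _ MM _ /negPf xy; rewrite MM xy scale0r. Qed.

Lemma projectors_sum : \sum_x M x = 1%:M.
Proof. by case: M_proj. Qed.

(** The block-diagonal part of [A] along the ranges of the projectors [M x]. *)
Definition pinching (A : 'M[C]_d) := \sum_x M x *m A *m M x.

Lemma trace_projector x A : \tr (M x *m A *m M x) = \tr (M x *m A).
Proof. by rewrite mxtrace_mulC mulmxA projector_idem. Qed.

Lemma trace_pinching A : \tr (pinching A) = \tr A.
Proof.
rewrite raddf_sum /=; under eq_bigr do rewrite trace_projector.
by rewrite -raddf_sum /= -mulmx_suml projectors_sum mul1mx.
Qed.

Lemma pinching_adj A : A^t* = A -> (pinching A)^t* = pinching A.
Proof.
move=> Ah; rewrite adjmx_sum; apply: eq_bigr => x _.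
by rewrite !adjmxM Ah projector_adj mulmxA.
Qed.

Lemma pinching_psd A : psd A -> psd (pinching A).
Proof.
by move=> A0; apply: psd_sum => x; rewrite -{1}projector_adj; exact: psd_congr.
Qed.

Lemma pinching_exp A k :
  pinching A ^+ k.+1 = \sum_x (M x *m A *m M x) ^+ k.+1.
Proof.
apply: orthogonal_sum_exp => x y xy.
by rewrite -!mulmxA [M x *m (M y *m _)]mulmxA projector_orth // mul0mx !mulmx0.
Qed.

(** For [X = G M_x], idempotence makes the two matrices [X X^*] and [X^* X]. *)
Lemma trace_exp_compression e (G : 'M[C]_(e, d)) x k :
  \tr ((G *m M x *m G^t*) ^+ k.+1) = \tr ((M x *m (G^t* *m G) *m M x) ^+ k.+1).
Proof.
have -> : G *m M x *m G^t* = (G *m M x) *m (M x *m G^t*).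
  by rewrite !mulmxA -[_ *m M x *m M x]mulmxA projector_idem.
by rewrite trace_exp_mulC !mulmxA.
Qed.

Lemma compression_psd e (G : 'M[C]_(e, d)) x : psd (G *m M x *m G^t*).
Proof.
have [M0 _ _] := M_proj.
by have := psd_congr (G^t*) (M0 x); rewrite trmxCK.
Qed.

(** Passes from size [e] to size [d]: as its blocks are orthogonal, the power traces of the pinching
    are sums over [x]. *)
Lemma sum_trfun_compression e (G : 'M[C]_(e, d)) g : g 0 = 0 ->
  \sum_x trfun g (G *m M x *m G^t*) = trfun g (pinching (G^t* *m G)).
Proof.
move=> g0; apply: sum_trfun => // [x||k].
- exact/psd_adj/compression_psd.
- exact/pinching_adj/psd_adj/psd_gram.
- rewrite pinching_exp raddf_sum; apply: eq_bigr => x _.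
  exact: trace_exp_compression.
Qed.

(** The complement [Q] of [M x] is again a projector, and the gap is the trace of [Q A Q]. *)
Lemma retr_projector_le A x : psd A -> retr (M x *m A) <= retr A.
Proof.
move=> A0; pose Q := 1%:M - M x.
have Qh : Q^t* = Q.
  by rewrite /Q -scaleN1r adjmxD adjmxZ projector_adj trmx1 map_mx1 rmorphN1.
have QQ : Q *m Q = Q.
  by rewrite /Q mulmxBl mul1mx mulmxBr mulmx1 projector_idem subrr subr0.
have : 0 <= retr (Q *m A *m Q).
  by apply: retr_ge0; rewrite -{1}Qh; exact: psd_congr.
rewrite /retr mxtrace_mulC mulmxA QQ /Q mulmxBl mul1mx !raddfB /=.
by rewrite subr_ge0.
Qed.

End Projections.

(** Boundedness is what lets an explicit family bound the supremum [Pguess] from below. *)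
Lemma Pguess_ubound d n (M : 'I_n -> 'M[C]_d) (rho : 'M[C]_d) :
  projective_measurement M ->
  ubound [set r : R | exists s : 'I_n -> 'M[C]_d,
    [/\ forall x, psd (s x), \sum_x s x = rho
      & r = \sum_x retr (M x *m s x)]]%classic (retr rho).
Proof.
move=> MP _ [s [s0 <- ->]]; rewrite retr_sum.
by apply: ler_sum => x _; exact: (retr_projector_le MP).
Qed.

(* The family [sqrt rho M_x sqrt rho] guesses the outcome with probability
   [tr (D ^ 2)], where D is the pinching of [sqrt rho]. *)
Lemma Pguess_ge d n (M : 'I_n -> 'M[C]_d) (rho : 'M[C]_d) :
    (0 < d)%N -> psd rho -> projective_measurement M ->
  d%:R^-1 * retr (mxsqrt rho) ^+ 2 <= Pguess rho M.
Proof.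
move=> d0 rho0 MP; set S := mxsqrt rho; pose D := pinching M S.
have Dh : D^t* = D by apply: (pinching_adj MP); exact: mxsqrt_adj.
have DD : retr (D *m D) = \sum_x retr (M x *m S *m M x *m S).
  rewrite -[D *m D]expr2 (pinching_exp MP) retr_sum; apply: eq_bigr => x _.
  rewrite /retr expr2 -mulmxE mxtrace_mulC !mulmxA -[_ *m M x *m M x]mulmxA.
  rewrite (projector_idem MP) mxtrace_mulC !mulmxA (projector_idem MP).
  by rewrite -!mulmxA mxtrace_mulC !mulmxA.
rewrite mulrC ler_pdivrMr ?ltr0n // mulrC.
(* Pinching preserves the trace, so Cauchy-Schwarz on the eigenvalues of [D] applies. *)
have -> : retr S = retr D by rewrite /retr (trace_pinching MP).
apply: le_trans (sqr_retr_le Dh) _; rewrite ler_wpM2l // DD.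
apply: ub_le_sup; first by exists (retr rho); exact: Pguess_ubound.
have [M0 _ _] := MP.
exists (fun x => S *m M x *m S); split; last first.
- by apply: eq_bigr => x _; rewrite !mulmxA.
- by rewrite -mulmx_suml -mulmx_sumr (projectors_sum MP) mulmx1 mxsqrt_sqr.
- by move=> x; have := psd_congr S (M0 x); rewrite mxsqrt_adj.
Qed.

Definition basis_mx d (b : 'I_d -> 'cV[C]_d) : 'M[C]_d := \matrix_(i, k) b k i 0.

Lemma basis_mx_col d (b : 'I_d -> 'cV[C]_d) k : col k (basis_mx b) = b k.
Proof. by apply/matrixP => i j; rewrite !mxE ord1. Qed.

Lemma basis_mx_inner d (b c : 'I_d -> 'cV[C]_d) (A : 'M[C]_d) i j :
  ((basis_mx b)^t* *m A *m basis_mx c) i j = inner (b i) (A *m c j).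
Proof.
rewrite entry_mulmx mulmxA mulmxA -!mulmxA -colE basis_mx_col !mulmxA.
by rewrite -adjmxM -colE basis_mx_col -mulmxA.
Qed.

Lemma basis_mx_unitary d (b : 'I_d -> 'cV[C]_d) : orthonormal_basis b ->
  (basis_mx b)^t* *m basis_mx b = 1%:M /\ basis_mx b *m (basis_mx b)^t* = 1%:M.
Proof.
move=> bo; have bb : (basis_mx b)^t* *m basis_mx b = 1%:M.
  apply/matrixP => i j; rewrite -[_ *m basis_mx b]mulmx1 -mulmxA mulmx1.
  rewrite -[(basis_mx b)^t*]mulmx1 basis_mx_inner mul1mx bo mxE.
  by [].
by split; [exact: bb|exact: mulmx1C].
Qed.

Lemma sum_ketbra d (b : 'I_d -> 'cV[C]_d) :
  \sum_k ketbra (b k) = basis_mx b *m (basis_mx b)^t*.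
Proof.
apply/matrixP => i j; rewrite summxE mxE; apply: eq_bigr => k _.
by rewrite !mxE big_ord1 !mxE.
Qed.

Lemma basis_measurement_projective d (b : 'I_d -> 'cV[C]_d) :
  orthonormal_basis b -> projective_measurement (basis_measurement b).
Proof.
move=> bo; split.
- by move=> x; have := psd_gram ((b x)^t*); rewrite trmxCK.
- move=> x y; rewrite /basis_measurement /ketbra mulmxA -[b x *m _ *m _]mulmxA.
  rewrite [_ *m b y]mx11_scalar -/(inner (b x) (b y)) bo mul_mx_scalar.
  by have [->|_] := eqVneq x y; rewrite -?scalemxAl ?scale0r ?mul0mx // scale1r.
- by rewrite sum_ketbra; have [] := basis_mx_unitary bo.
Qed.

End Measurements.

Lemma sqrt_gram (R : realType) d n (A : 'M[R[i]]_d) (B : 'M[R[i]]_(d, n)) :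
  psd A -> (mxsqrt A *m B)^t* *m (mxsqrt A *m B) = B^t* *m A *m B.
Proof.
move=> A0; rewrite (adjmxM (mxsqrt A) B) mxsqrt_adj.
by rewrite -[in RHS](mxsqrt_sqr A0) !mulmxA.
Qed.

(** * Unbiased bases *)

Section Diagonalised.
Variable R : realType.
Local Notation C := R[i].
Variables (d : nat) (rho : 'M[C]_d) (u : 'I_d -> 'cV[C]_d) (l : 'I_d -> R).
Hypothesis u_basis : orthonormal_basis u.
Hypothesis u_eigen : forall k, rho *m u k = (l k)%:C *: u k.

Lemma eigenbasis_mul :
  rho *m basis_mx u = basis_mx u *m diag_mx (\row_k (l k)%:C).
Proof.
apply/matrixP => i k; rewrite mul_mx_diag.
have -> : (rho *m basis_mx u) i k = (rho *m u k) i 0.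
  by rewrite -[u k]basis_mx_col colE mulmxA -colE [RHS]mxE.
by rewrite u_eigen !mxE mulrC.
Qed.

Lemma eigenbasis_diag :
  rho = basis_mx u *m diag_mx (\row_k (l k)%:C) *m (basis_mx u)^t*.
Proof.
have [_ UU] := basis_mx_unitary u_basis.
by rewrite -eigenbasis_mul -mulmxA UU mulmx1.
Qed.

Lemma eigenbasis_adj : rho^t* = rho.
Proof.
rewrite eigenbasis_diag !adjmxM trmxCK mulmxA adjmx_diag // => i.
by rewrite mxE; apply/complex_realP; eexists.
Qed.

Lemma eigenbasis_trace_exp k : \tr (rho ^+ k.+1) = (\sum_i l i ^+ k.+1)%:C.
Proof.
have [UU _] := basis_mx_unitary u_basis.
rewrite eigenbasis_diag -mulmxA trace_exp_mulC -mulmxA UU mulmx1.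
rewrite diag_mx_exp mxtrace_diag rmorph_sum.
by apply: eq_bigr => i _; rewrite !mxE rmorphXn.
Qed.

Lemma trfun_eigenbasis g : g 0 = 0 -> trfun g rho = \sum_k g (l k).
Proof.
by move=> g0; apply: trfun_of_traces => //;
  [exact: eigenbasis_adj|exact: eigenbasis_trace_exp].
Qed.

(** [eigenvalue] speaks of row vectors: a nonzero coordinate of a left eigenvector singles out some
    [l k], and the rows of the adjoint of [basis_mx u] are left eigenvectors. *)
Lemma eigenvalue_eigenbasis (r : R) :
  eigenvalue rho r%:C <-> exists k, r = l k.
Proof.
have [UU' UU] := basis_mx_unitary u_basis.
split=> [/eigenvalueP[v vE v0]|[k ->]].
  have [k vk] : exists k, (v *m basis_mx u) 0 k != 0.
    apply: contrapT => /forallNP H; move/eqP: v0; apply.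
    rewrite -[v]mulmx1 -UU mulmxA; suff -> : v *m basis_mx u = 0 by rewrite mul0mx.
    by apply/rowP => k; rewrite [RHS]mxE; apply/eqP/negPn/negP/H.
  exists k; apply: (@complexI R).
  have : (v *m rho *m basis_mx u) 0 k = (v *m basis_mx u) 0 k * (l k)%:C.
    by rewrite -mulmxA eigenbasis_mul mulmxA mul_mx_diag !mxE.
  by rewrite vE -scalemxAl mxE mulrC => /(mulfI vk).
apply/eigenvalueP; exists (row k ((basis_mx u)^t*)).
  rewrite -row_mul {1}eigenbasis_diag !mulmxA UU' mul1mx row_mul.
  by rewrite row_diag_mx -scalemxAl -rowE mxE.
apply/eqP => /(congr1 (fun v => (v *m basis_mx u) 0 k)).
by rewrite -row_mul UU' mul0mx !mxE eqxx => /eqP; rewrite oner_eq0.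
Qed.

Lemma lambda_max_eigenbasis : (0 < d)%N ->
  exists2 k, lambda_max rho = l k & forall j, l j <= l k.
Proof.
move=> d0; pose k := [arg max_(i > Ordinal d0) l i]%O.
have kmax j : l j <= l k.
  by rewrite /k; case: arg_maxP => // i _; apply.
exists k => //; apply/eqP; rewrite eq_le; apply/andP; split.
  apply: ge_sup; first by exists (l k); apply/eigenvalue_eigenbasis; exists k.
  by move=> _ /eigenvalue_eigenbasis[j ->].
apply: ub_le_sup; last by apply/eigenvalue_eigenbasis; exists k.
by exists (l k) => _ /eigenvalue_eigenbasis[j ->].
Qed.

Section Unbiased.
Variable m : 'I_d -> 'cV[C]_d.
Hypothesis m_unbiased :
  forall i k, `|inner (m i) (u k)| = ((Num.sqrt (d%:R : R))^-1)%:C.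

Lemma unbiased_sqr i k : `|inner (m i) (u k)| ^+ 2 = (d%:R^-1 : R)%:C.
Proof. by rewrite m_unbiased -rmorphXn exprVn sqr_sqrtr. Qed.

(** Expanding in the eigenbasis weights every [l k] by the same squared overlap [1 / d]. *)
Lemma unbiased_expectation i :
  inner (m i) (rho *m m i) = (d%:R^-1 * \sum_k l k)%:C.
Proof.
rewrite /inner {1}eigenbasis_diag mulmxA.
have -> : (m i)^t* *m (basis_mx u *m diag_mx (\row_k (l k)%:C) *m (basis_mx u)^t*)
    *m m i = ((m i)^t* *m basis_mx u) *m diag_mx (\row_k (l k)%:C) *m
      ((m i)^t* *m basis_mx u)^t*.
  by rewrite adjmxM trmxCK !mulmxA.
have E k : ((m i)^t* *m basis_mx u) 0 k = inner (m i) (u k).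
  by rewrite /inner -[u k]basis_mx_col colE mulmxA -colE [RHS]mxE.
rewrite mul_mx_diag mxE mulr_sumr rmorph_sum.
apply: eq_bigr => k _; rewrite [RHS]rmorphM /= -(unbiased_sqr i k) -E normCK.
by move: (_ *m basis_mx u) => a; rewrite !mxE mulrAC.
Qed.

(* In the eigenbasis of rho the amplitudes of [m i] all have modulus
   [d ^-1/2], so the triangle inequality and Minkowski's inequality bound the
   guessing probability by the diagonal entries of the [s i]. *)
Lemma unbiased_guess_le (s : 'I_d -> 'M[C]_d) :
    (forall i, psd (s i)) -> \sum_i s i = rho ->
  \sum_i retr (ketbra (m i) *m s i) <= d%:R^-1 * (\sum_k Num.sqrt (l k)) ^+ 2.
Proof.
move=> s0 srho; have [UU' UU] := basis_mx_unitary u_basis.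
(* The Gram matrix of [Z i] is [s i] written in the basis [u]. *)
pose Z i := mxsqrt (s i) *m basis_mx u.
pose w i j k := complex.Re `|Z i j k|.
have wE i j k : (w i j k)%:C = `|Z i j k| by rewrite /w RRe_real ?normr_real.
(* Diagonal entry [k] of [rho] in its eigenbasis collects the squared norms of the columns [k] of
   all [Z i]. *)
have lE k : l k = \sum_(p : 'I_d * 'I_d) w p.1 p.2 k ^+ 2.
  rewrite -(pair_bigA _ (fun i j => w i j k ^+ 2)) /=.
  apply: (@complexI R); rewrite rmorph_sum.
  transitivity (((basis_mx u)^t* *m rho *m basis_mx u) k k).
    by rewrite -mulmxA eigenbasis_mul mulmxA UU' mul1mx !mxE eqxx.
  rewrite -srho mulmx_sumr mulmx_suml summxE; apply: eq_bigr => i _.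
  rewrite -sqrt_gram // -/(Z i) rmorph_sum.
  rewrite mxE; apply: eq_bigr => j _; rewrite rmorphXn /= wE normCK !mxE.
  by rewrite mulrC.
(* The left side is the squared norm of [Z i *m a], where [a] holds the coordinates of [m i]; the
   triangle inequality is applied in each row [j]. *)
have G i : retr (ketbra (m i) *m s i) <= d%:R^-1 * \sum_j (\sum_k w i j k) ^+ 2.
  pose a := (basis_mx u)^t* *m m i.
  have aE k : `|a k 0| = ((Num.sqrt (d%:R : R))^-1)%:C.
    rewrite -(m_unbiased i k) -[RHS]norm_conjC inner_conj; congr Num.norm.
    by rewrite /a /inner !mxE; apply: eq_bigr => j _; rewrite !mxE.
  have -> : retr (ketbra (m i) *m s i) = complex.Re (\sum_j `|(Z i *m a) j 0| ^+ 2).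
    congr complex.Re; rewrite /ketbra -mulmxA mxtrace_mulC -sqrt_gram //.
    have -> : mxsqrt (s i) *m m i = Z i *m a.
      by rewrite /a /Z -mulmxA (mulmxA (basis_mx u)) UU mul1mx.
    rewrite trace_mx11 mxE; apply: eq_bigr => j _.
    by rewrite !mxE normCK mulrC.
  rewrite -lecR RRe_real; last by apply: rpred_sum => j _; rewrite rpredX ?normr_real.
  rewrite mulr_sumr rmorph_sum; apply: ler_sum => j _ /=.
  have -> : (d%:R^-1 * (\sum_k w i j k) ^+ 2) =
     (\sum_k w i j k * (Num.sqrt (d%:R : R))^-1) ^+ 2.
    by rewrite -mulr_suml exprMn exprVn sqr_sqrtr // mulrC.
  rewrite rmorphXn lerXn2r ?nnegrE ?normr_ge0 //.
    rewrite lecR; apply: sumr_ge0 => k _; rewrite mulr_ge0 ?invr_ge0 ?sqrtr_ge0 //.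
    by rewrite -lecR wE normr_ge0.
  rewrite mxE; apply: le_trans (ler_norm_sum _ _ _) _.
  rewrite rmorph_sum; apply: ler_sum => k _.
  by rewrite normrM rmorphM /= wE aE.
(* What remains is Minkowski's inequality, with the pairs [(i, j)] as coordinates and one vector for
   each [k]. *)
apply: le_trans (ler_sum _ (fun i _ => G i)) _; rewrite -mulr_sumr.
rewrite ler_wpM2l ?invr_ge0 //; under [X in _ <= X ^+ 2]eq_bigr do rewrite lE.
rewrite (pair_bigA _ (fun i j => (\sum_k w i j k) ^+ 2)) /=.
exact: sum_sqr_sum_le.
Qed.

End Unbiased.
End Diagonalised.

(** * Pinchings in a basis, transposes and conjugate bases *)

Section Pinchings.
Variable R : realType.
Local Notation C := R[i].

Lemma pinching_basis_const d (b : 'I_d -> 'cV[C]_d) (A : 'M[C]_d) (c : C) :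
    orthonormal_basis b -> (forall i, inner (b i) (A *m b i) = c) ->
  pinching (basis_measurement b) A = c%:M.
Proof.
move=> bo bA; have [_ _ b1] := basis_measurement_projective bo.
rewrite -scalemx1 -b1 scaler_sumr; apply: eq_bigr => i _.
rewrite /basis_measurement /ketbra -!mulmxA [A *m (_ *m _)]mulmxA.
rewrite [(b i)^t* *m (_ *m _)]mulmxA [_ *m (A *m b i)]mx11_scalar.
by rewrite -/(inner _ _) bA mul_scalar_mx scalemxAr.
Qed.

(** Reshaping the purification turns operators on A into their transposes, so the pinchings that
    occur use these. *)
Lemma projective_measurement_tr d n (M : 'I_n -> 'M[C]_d) :
  projective_measurement M -> projective_measurement (fun x => (M x)^T).
Proof.
move=> MP; split.
- move=> x; have h : ((M x)^T)^t* = (M x)^T.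
    by rewrite -{2}(projector_adj MP x); apply/matrixP => i j; rewrite !mxE.
  by rewrite -(projector_idem MP x) trmx_mul -{1}h; exact: psd_gram.
- move=> x y; rewrite -trmx_mul; have [_ -> _] := MP.
  rewrite [x == y]eq_sym; case: (eqVneq y x) => [->|_]; first by rewrite !scale1r.
  by rewrite !scale0r trmx0.
- have -> : \sum_x (M x)^T = (\sum_x M x)^T by rewrite raddf_sum.
  by rewrite (projectors_sum MP) trmx1.
Qed.

Definition conjv d (b : 'I_d -> 'cV[C]_d) (i : 'I_d) : 'cV[C]_d :=
  map_mx Num.conj (b i).

Lemma inner_conjv d (b c : 'I_d -> 'cV[C]_d) (A : 'M[C]_d) i j :
  inner (conjv b i) (A^T *m conjv c j) = inner (c j) (A *m b i).
Proof.
rewrite /inner.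
suff <- : ((conjv b i)^t* *m (A^T *m conjv c j))^T = (c j)^t* *m (A *m b i).
  by rewrite [RHS]mxE.
rewrite !trmx_mul trmxK mulmxA; congr (_ *m _ *m _).
  by apply/matrixP => x y; rewrite !mxE.
by apply/matrixP => x y; rewrite !mxE conjCK.
Qed.
Lemma orthonormal_conjv d (b : 'I_d -> 'cV[C]_d) :
  orthonormal_basis b -> orthonormal_basis (conjv b).
Proof.
move=> bo i j; rewrite -[conjv b j]mul1mx -[1%:M]trmx1 inner_conjv mul1mx bo.
by rewrite eq_sym.
Qed.

Lemma basis_measurement_tr d (b : 'I_d -> 'cV[C]_d) :
  (fun x => (basis_measurement b x)^T) = basis_measurement (conjv b).
Proof.
apply/funext => i; apply/matrixP => j k.
by rewrite !mxE !big_ord1 !mxE conjCK mulrC.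
Qed.

End Pinchings.

(** * The state of the purifying system *)

Section Environment.
Variable R : realType.
Local Notation C := R[i].

Lemma trmx_exp n (A : 'M[C]_n) k : (A^T) ^+ k = (A ^+ k)^T.
Proof.
elim: k => [|k IH]; first by rewrite !expr0 -idmxE trmx1.
by rewrite exprS exprSr IH -!mulmxE trmx_mul.
Qed.

Lemma sum_mxtens_index m n (F : 'I_(m * n) -> C) :
  \sum_p F p = \sum_i \sum_j F (mxtens_index (i, j)).
Proof.
rewrite pair_bigA (reindex (@mxtens_index m n)) /=.
  by apply: eq_bigr => -[].
by exists (@mxtens_unindex m n) => p _; [exact: mxtens_indexK|exact: mxtens_unindexK].
Qed.

Lemma tensmxZr (m1 m2 n1 n2 : nat) (c : C) (A : 'M[C]_(m1, n1))
    (B : 'M[C]_(m2, n2)) : tensmx A (c *: B) = c *: tensmx A B.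
Proof. by apply/matrixP => i j; rewrite !mxE mulrCA. Qed.

Lemma adjmx_tens (m1 m2 n1 n2 : nat) (A : 'M[C]_(m1, n1)) (B : 'M[C]_(m2, n2)) :
  (tensmx A B)^t* = tensmx (A^t*) (B^t*).
Proof. by apply/matrixP => i j; rewrite !mxE rmorphM. Qed.

Variables (d e : nat) (rho : 'M[C]_d) (Psi : 'cV[C]_(d * e)).
Hypothesis Psi_pur : purification rho Psi.

(** [Psi] is the sum over [k] of [e_k (x) G e_k], with [e_k] the standard basis of A. *)
Definition steering_mx : 'M[C]_(e, d) :=
  \matrix_(i, k) Psi (mxtens_index (k, i)) 0.

Local Notation G := steering_mx.

Lemma steering_gram : G^t* *m G = rho^T.
Proof.
have [_ <-] := Psi_pur; apply/matrixP => k j; rewrite !mxE.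
by apply: eq_bigr => i _; rewrite !mxE big_ord1 !mxE mulrC.
Qed.

Lemma ptrace_l_steering (M : 'M[C]_d) :
  ptrace_l (tensmx M (1%:M : 'M[C]_e) *m ketbra Psi) = G *m M^T *m G^t*.
Proof.
apply/matrixP => i j; rewrite !mxE; apply: eq_bigr => k _.
rewrite mulmxA !mxE big_ord1 !mxE; congr (_ * _).
rewrite sum_mxtens_index; apply: eq_bigr => a _; rewrite (bigD1 i) //= big1 ?addr0.
  by rewrite tensmxE !mxE eqxx mulr1 mulrC.
by move=> b bi; rewrite tensmxE mxE eq_sym (negPf bi) mulr0 mul0r.
Qed.

Lemma rho_psd : psd rho.
Proof.
have h : (G^T)^t* = (G^t*)^T by apply/matrixP => i j; rewrite !mxE.
by rewrite -[rho]trmxK -steering_gram trmx_mul -h; have := psd_gram ((G^T)^t*);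
  rewrite trmxCK h.
Qed.

Section Outcomes.
Variables (n : nat) (M : 'I_n -> 'M[C]_d).
Hypothesis M_proj : projective_measurement M.

Local Notation tau x := (G *m (M x)^T *m G^t*).
Let MT_proj := projective_measurement_tr M_proj.

Lemma tau_psd x : psd (tau x).
Proof. exact: (compression_psd MT_proj). Qed.

Lemma trace_tau x : \tr (tau x) = (outcome_prob rho M x)%:C.
Proof.
have tE : \tr (tau x) = \tr (M x *m rho).
  rewrite -mulmxA mxtrace_mulC -mulmxA steering_gram -trmx_mul mxtrace_tr.
  by rewrite mxtrace_mulC.
rewrite /outcome_prob /retr -tE RRe_real // ger0_real //.
exact/psd_trace_ge0/tau_psd.
Qed.

Lemma outcome_prob_ge0 x : 0 <= outcome_prob rho M x.
Proof. by rewrite -lecR -trace_tau; exact/psd_trace_ge0/tau_psd. Qed.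

(** [tau x] is [B B^*], where [B] has the outcome probability as squared Frobenius norm. Hence sums
    over outcomes of positive probability extend to all [x]. *)
Lemma tau_eq0 x : outcome_prob rho M x = 0 -> tau x = 0.
Proof.
move=> p0; have tauE : tau x = (G *m (M x)^T) *m (G *m (M x)^T)^t*.
  rewrite adjmxM (projector_adj MT_proj) mulmxA -[_ *m _ *m (M x)^T]mulmxA.
  by rewrite (projector_idem MT_proj).
have := trace_tau x; rewrite p0 tauE -{1}[G *m _]trmxCK => /trace_adj_mul_eq0 ->.
by rewrite mulmx0.
Qed.

Lemma post_stateE x :
  post_state rho M Psi x = ((outcome_prob rho M x)^-1)%:C *: tau x.
Proof. by rewrite /post_state ptrace_l_steering. Qed.

Lemma post_stateZ x : outcome_prob rho M x != 0 ->
  (outcome_prob rho M x)%:C *: post_state rho M Psi x = tau x.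
Proof. by move=> p0; rewrite post_stateE scalerA -rmorphM /= divff // scale1r. Qed.

Lemma cq_stateE :
  cq_state rho M Psi = \sum_x tensmx (delta_mx x x : 'M[C]_n) (tau x).
Proof.
rewrite /cq_state big_mkcond; apply: eq_bigr => x _.
case: eqP => [p0|/eqP p0] /=; first by rewrite tau_eq0 // tensmx0.
by rewrite -tensmxZr post_stateZ.
Qed.

Lemma cq_state_adj : (cq_state rho M Psi)^t* = cq_state rho M Psi.
Proof.
rewrite cq_stateE adjmx_sum; apply: eq_bigr => x _.
rewrite adjmx_tens (psd_adj (tau_psd x)); congr (tensmx _ _).
by rewrite trmx_delta map_delta_mx.
Qed.

Lemma ptrace_l_cq_state : ptrace_l (cq_state rho M Psi) = G *m G^t*.
Proof.
have -> : G *m G^t* = \sum_x tau x.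
  by rewrite -mulmx_suml -mulmx_sumr (projectors_sum MT_proj) mulmx1.
rewrite cq_stateE; apply/matrixP => i j; rewrite mxE summxE.
under eq_bigr do rewrite summxE.
rewrite exchange_big; apply: eq_bigr => x _ /=.
rewrite (bigD1 x) //= big1 ?addr0; last first.
  by move=> y /negPf yx; rewrite tensmxE mxE yx mul0r.
by rewrite tensmxE mxE !eqxx mul1r.
Qed.

(** The classical register keeps the blocks orthogonal, so the power traces of both sides are sums
    of those of the [tau x]. *)
Lemma trfun_cq_state g : g 0 = 0 ->
  trfun g (cq_state rho M Psi) = trfun g (pinching (fun x => (M x)^T) rho^T).
Proof.
move=> g0; apply: eq_trfun => //; first exact: cq_state_adj.
  by rewrite -steering_gram; apply: (pinching_adj MT_proj); exact/psd_adj/psd_gram.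
move=> k; rewrite (pinching_exp MT_proj) cq_stateE orthogonal_sum_exp; last first.
  by move=> x y xy; rewrite tensmx_mul mul_delta_mx_0 // tens0mx.
rewrite !raddf_sum; apply: eq_bigr => x _ /=.
rewrite -steering_gram -(trace_exp_compression MT_proj).
have -> j : (tensmx (delta_mx x x : 'M[C]_n) (tau x)) ^+ j.+1 =
    tensmx (delta_mx x x) (tau x ^+ j.+1).
  elim: j => [|j IH]; first by rewrite !expr1.
  by rewrite exprS IH -mulmxE tensmx_mul mul_delta_mx mulmxE -exprS.
rewrite /mxtrace sum_mxtens_index.
rewrite (bigD1 x) //= [X in _ + X]big1 ?addr0; last first.
  by move=> y /negPf yx; rewrite big1 // => b _; rewrite tensmxE mxE yx mul0r.
by apply: eq_bigr => b _; rewrite tensmxE mxE eqxx mul1r.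
Qed.

Lemma trfun_reduced_state g : g 0 = 0 -> trfun g (G *m G^t*) = trfun g rho.
Proof.
move=> g0; apply: eq_trfun => //; last 1 first.
- move=> k; rewrite trace_exp_mulC steering_gram trmx_exp mxtrace_tr.
  by [].
- by rewrite adjmxM trmxCK.
- exact/psd_adj/rho_psd.
Qed.

Lemma HvN_pinching : HvN rho M Psi =
  - trfun (fun t => t * log2 t) (pinching (fun x => (M x)^T) rho^T)
  - vn_entropy rho.
Proof.
have h0 : 0 * log2 0 = 0 :> R by rewrite mul0r.
rewrite /HvN ptrace_l_cq_state (vn_entropyE cq_state_adj) trfun_cq_state //.
rewrite (vn_entropyE (psd_adj rho_psd)) vn_entropyE ?trfun_reduced_state //.
by rewrite adjmxM trmxCK.
Qed.

(** Up to normalisation, each fidelity is the root trace of a compression by [Q G], with [Q] the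
    square root of [S]. *)
Lemma sum_fidelity (S : 'M[C]_e) : psd S ->
  \sum_(x | outcome_prob rho M x != 0)
    Num.sqrt (outcome_prob rho M x) * fidelity (post_state rho M Psi x) S =
  trfun Num.sqrt (pinching (fun x => (M x)^T) (G^t* *m S *m G)).
Proof.
move=> S0; set Q := mxsqrt S; have Qh : Q^t* = Q by exact: mxsqrt_adj.
have -> : G^t* *m S *m G = (Q *m G)^t* *m (Q *m G) by rewrite sqrt_gram.
rewrite -(sum_trfun_compression MT_proj) ?sqrtr0 // big_mkcond.
apply: eq_bigr => x _.
have E : Q *m G *m (M x)^T *m (Q *m G)^t* = Q *m tau x *m Q.
  by rewrite (adjmxM Q G) Qh !mulmxA.
have Eh : (Q *m tau x *m Q)^t* = Q *m tau x *m Q.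
  by apply: psd_adj; rewrite -{1}Qh; apply: psd_congr; exact: tau_psd.
rewrite E; case: eqP => [p0|/eqP p0] /=.
  rewrite (tau_eq0 p0) mulmx0 mul0mx.
  have -> : (0 : 'M[C]_e) = (0%:C)%:M by rewrite raddf0.
  by rewrite trfun_scalar ?sqrtr0 // mulr0.
rewrite /fidelity /mxsqrt -/(mxsqrt S) -/Q retr_mxfun post_stateE.
(* The weight [sqrt p_x] cancels the root of the normalising factor [1 / p_x]. *)
rewrite -scalemxAr -scalemxAl trfun_sqrtZ ?invr_ge0 ?outcome_prob_ge0 //.
rewrite mulrA -sqrtrM ?outcome_prob_ge0 // divff // sqrtr1 mul1r.
by [].
Qed.

End Outcomes.
End Environment.

(** * Spectrum of the reduced state and the max-entropy bound *)

Section StateSpectrum.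
Variable R : realType.
Local Notation C := R[i].

(** Each eigenvalue is an expectation of [rho], hence nonnegative in the order of [R[i]] and
    therefore real. *)
Lemma state_eigenvalues d (rho : 'M[C]_d) (u : 'I_d -> 'cV[C]_d) :
    quantum_state rho -> orthonormal_basis u ->
    (forall k, exists c : C, rho *m u k = c *: u k) ->
  exists l : 'I_d -> R, [/\ forall k, 0 <= l k, \sum_k l k = 1
    & forall k, rho *m u k = (l k)%:C *: u k].
Proof.
move=> [rho0 rho1] uo /choice[c cE].
have cin k : c k = inner (u k) (rho *m u k).
  by rewrite cE /inner -scalemxAr mxE -/(inner _ _) uo eqxx mulr1.
have c0 k : 0 <= c k by rewrite cin; exact: rho0.
have cR k : (complex.Re (c k))%:C = c k by rewrite RRe_real ?ger0_real.
have lE k : rho *m u k = (complex.Re (c k))%:C *: u k by rewrite cR.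
exists (fun k => complex.Re (c k)); split=> //.
  by move=> k; rewrite -lecR cR.
by apply: (@complexI R); rewrite -(eigenbasis_trace_exp uo lE 0) expr1 rho1.
Qed.

Variables (d : nat) (rho : 'M[C]_d) (u : 'I_d -> 'cV[C]_d) (l : 'I_d -> R).
Hypothesis u_basis : orthonormal_basis u.
Hypothesis u_eigen : forall k, rho *m u k = (l k)%:C *: u k.
Variables (e : nat) (Psi : 'cV[C]_(d * e)).
Hypothesis Psi_pur : purification rho Psi.

Local Notation G := (steering_mx Psi).

(** The nonnegative function [max 0 (t - r)] has trace zero on [rho], hence on [G G^*], so it
    vanishes at each eigenvalue. *)
Lemma eigs_reduced_state_le (r : R) i :
  0 <= r -> (forall k, l k <= r) -> eigs (G *m G^t*) i <= r.
Proof.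
move=> r0 lr; pose g (t : R) := Num.max 0 (t - r).
have g0 : g 0 = 0 by rewrite /g sub0r; apply/max_idPl; rewrite oppr_le0.
have gge t : 0 <= g t by rewrite /g le_max lexx.
have := trfun_reduced_state Psi_pur g0.
rewrite (trfun_eigenbasis u_basis u_eigen g0) [RHS]big1; last first.
  by move=> k _; apply/max_idPl; rewrite subr_le0.
move=> /psumr_eq0P /(_ i) => /(_ (fun k _ => gge _) isT) /eqP.
by rewrite eq_le => /andP[]; rewrite ge_max lexx subr_le0.
Qed.

(** Cauchy-Schwarz and trace preservation leave [d] times the trace of [S G G^*], and the spectrum
    of [G G^*] lies below [r]. *)
Lemma sum_fidelity_le n (M : 'I_n -> 'M[C]_d) (S : 'M[C]_e) (r : R) :
    projective_measurement M -> quantum_state S ->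
    0 <= r -> (forall k, l k <= r) ->
  (\sum_(x | outcome_prob rho M x != 0)
    Num.sqrt (outcome_prob rho M x) * fidelity (post_state rho M Psi x) S) ^+ 2
  <= d%:R * r.
Proof.
move=> MP [S0 S1] r0 lr; rewrite (sum_fidelity Psi_pur MP S0).
have MTP := projective_measurement_tr MP.
have w0 := psd_congr G S0.
apply: le_trans (sqr_trfun_sqrt_le (pinching_psd MTP w0)) _.
rewrite ler_wpM2l // /retr (trace_pinching MTP) -mulmxA mxtrace_mulC -mulmxA.
have GGh : (G *m G^t*)^t* = G *m G^t* by rewrite adjmxM trmxCK.
have := retr_mul_le S0 GGh (fun i => eigs_reduced_state_le i r0 lr).
by rewrite {2}/retr S1 mulr1.
Qed.

Lemma eigenvector_conj k : rho^T *m conjv u k = (l k)%:C *: conjv u k.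
Proof.
have {1}-> : rho^T = map_mx Num.conj rho.
  rewrite -{1}(eigenbasis_adj u_basis u_eigen).
  by apply/matrixP => i j; rewrite !mxE.
rewrite /conjv -map_mxM u_eigen.
by apply/matrixP => i j; rewrite !mxE rmorphM; congr (_ * _); exact: conjC_real.
Qed.

Variable m : 'I_d -> 'cV[C]_d.
Hypothesis m_basis : orthonormal_basis m.
Hypothesis m_unbiased :
  forall i k, `|inner (m i) (u k)| = ((Num.sqrt (d%:R : R))^-1)%:C.

(** For the pure state along [G *m conjv u k], the matrix [G^* S G] is [l k] times a projector
    unbiased to [conjv m]. Its pinching is the scalar [l k / d], and the squared root trace is
    [d^2 * (l k / d)]. *)
Lemma sum_fidelity_unbiased k : (0 < d)%N -> 0 < l k ->
  exists2 S : 'M[C]_e, quantum_state S &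
    (\sum_(x | outcome_prob rho (basis_measurement m) x != 0)
      Num.sqrt (outcome_prob rho (basis_measurement m) x) *
        fidelity (post_state rho (basis_measurement m) Psi x) S) ^+ 2
    = d%:R * l k.
Proof.
move=> d0 lk; have d0' : (0 : R) < d%:R by rewrite ltr0n.
(* [G *m conjv u k] has squared norm [l k], because [G^* G = rho^T]. *)
pose c : C := ((Num.sqrt (l k))^-1)%:C.
pose v : 'cV[C]_e := c *: (G *m conjv u k).
have cc : c * c = ((l k)^-1)%:C.
  by rewrite /c -rmorphM /= -invfM -expr2 sqr_sqrtr ?ltW.
have ch : c^* = c by exact: conjC_real.
have Gv : G^t* *m v = (c * (l k)%:C) *: conjv u k.
  by rewrite /v -scalemxAr mulmxA (steering_gram Psi_pur) eigenvector_conj scalerA.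
have uu i j : inner (conjv u i) (conjv u j) = (i == j)%:R.
  exact: (orthonormal_conjv u_basis).
have lV : ((l k)^-1)%:C * (l k)%:C = 1 :> C.
  by rewrite -rmorphM /= mulVf ?gt_eqF.
have S0 : psd (ketbra v) by have := psd_gram (v^t*); rewrite trmxCK.
have S1 : \tr (ketbra v) = 1.
  rewrite mxtrace_mulC {1}/v adjmxZ adjmxM ch -scalemxAl -mulmxA Gv.
  rewrite -scalemxAr scalerA mulrA cc lV scale1r trace_mx11.
  by have := uu k k; rewrite eqxx.
exists (ketbra v) => //.
rewrite (sum_fidelity Psi_pur (basis_measurement_projective m_basis) S0).
rewrite basis_measurement_tr.
rewrite (@pinching_basis_const _ _ _ _ (d%:R^-1 * l k)%:C) //.
- rewrite trfun_scalar ?sqrtr0 // exprMn sqr_sqrtr; last first.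
    by rewrite mulr_ge0 ?invr_ge0 ?ltW.
  by rewrite expr2 -mulrA mulVKf ?gt_eqF.
- exact: orthonormal_conjv.
move=> i; have -> : G^t* *m ketbra v *m G = (l k)%:C *: ketbra (conjv u k).
  have -> : G^t* *m ketbra v *m G = (G^t* *m v) *m (G^t* *m v)^t*.
    by rewrite adjmxM trmxCK /ketbra !mulmxA.
  have cl : (c * (l k)%:C)^* = c * (l k)%:C by rewrite /c -rmorphM /= conjC_real.
  rewrite Gv adjmxZ cl -scalemxAl -scalemxAr scalerA.
  by rewrite mulrACA cc mulrA lV mul1r.
have E : inner (conjv m i) (conjv u k) = inner (u k) (m i).
  by rewrite -[conjv u k]mul1mx -[1%:M]trmx1 inner_conjv mul1mx.
have E' : inner (conjv u k) (conjv m i) = (inner (u k) (m i))^*.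
  by rewrite -E inner_conj.
rewrite /inner -scalemxAl -scalemxAr mxE /ketbra.
have -> : (conjv m i)^t* *m (conjv u k *m (conjv u k)^t* *m conjv m i) =
    ((conjv m i)^t* *m conjv u k) *m ((conjv u k)^t* *m conjv m i).
  by rewrite !mulmxA.
rewrite [(conjv u k)^t* *m _]mx11_scalar mul_mx_scalar mxE.
rewrite -/(inner (conjv u k) _) -/(inner (conjv m i) _) E E'
  [X in _ * X]mulrC -normCK.
rewrite -norm_conjC inner_conj (unbiased_sqr m_unbiased).
by rewrite -rmorphM /= mulrC.
Qed.

End StateSpectrum.

(** * Optimality among projective measurements and the attained values *)

Theorem mainTheorem5 (R : realType) (d : nat) (rho : 'M[R[i]]_d)
    (u m : 'I_d -> 'cV[R[i]]_d)
    (rho_state : quantum_state rho)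
    (u_basis : orthonormal_basis u)
    (u_eigen : forall k, exists l : R[i], rho *m u k = l *: u k)
    (m_basis : orthonormal_basis m)
    (m_unbiased : forall i k,
       `|inner (m i) (u k)| = ((Num.sqrt (d%:R : R))^-1)%:C)
    (e : nat) (Psi : 'cV[R[i]]_(d * e)) (Psi_pur : purification rho Psi) :
  [/\ projective_measurement (basis_measurement m),
      forall (n : nat) (N : 'I_n -> 'M[R[i]]_d), projective_measurement N ->
        [/\ Hmin rho N <= Hmin rho (basis_measurement m),
            HvN rho N Psi <= HvN rho (basis_measurement m) Psi
          & Hmax rho N Psi <= Hmax rho (basis_measurement m) Psi]
    & [/\ Hmin rho (basis_measurement m)
            = - log2 (d%:R^-1 * retr (mxsqrt rho) ^+ 2),
          HvN rho (basis_measurement m) Psi = log2 d%:R - vn_entropy rho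
        & Hmax rho (basis_measurement m) Psi
            = log2 d%:R + log2 (lambda_max rho)]].
Proof.
have [rho0 rho1] := rho_state.
have [l [l0 l1 lE]] := state_eigenvalues rho_state u_basis u_eigen.
have d0 : (0 < d)%N.
  case: posnP => // d0; move: l1; rewrite big1 => [/eqP|k _].
    by rewrite eq_sym oner_eq0.
  by have := ltn_ord k; rewrite {2}d0.
have d0' : (0 : R) < d%:R by rewrite ltr0n.
have [k lmaxE lmax] := lambda_max_eigenbasis u_basis lE d0.
(* The largest eigenvalue is at least the average [1 / d]; this yields [0 < l k] and a nonnegative
   logarithm below. *)
have dl : 1 <= d%:R * l k.
  rewrite -[leLHS]l1; apply: le_trans (ler_sum _ (fun j _ => lmax j)) _.
  by rewrite sumr_const card_ord mulr_natl.
have lk : 0 < l k by rewrite -(pmulr_rgt0 _ d0') (lt_le_trans ltr01).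
have sqrtE : retr (mxsqrt rho) = \sum_k Num.sqrt (l k).
  by rewrite retr_mxfun (trfun_eigenbasis u_basis lE) ?sqrtr0.
have sqrt_gt0 : 0 < d%:R^-1 * retr (mxsqrt rho) ^+ 2.
  rewrite mulr_gt0 ?invr_gt0 // exprn_gt0 // sqrtE (bigD1 k) //=.
  by rewrite ltr_pwDl ?sqrtr_gt0 // sumr_ge0 // => j _; exact: sqrtr_ge0.
have mP := basis_measurement_projective m_basis.
have PguessE : Pguess rho (basis_measurement m) =
    d%:R^-1 * retr (mxsqrt rho) ^+ 2.
  apply/eqP; rewrite eq_le Pguess_ge // andbT /Pguess.
  (* On the empty set [sup] is 0, which lies below the positive bound. *)
  set A := (X in sup X); have [->|/set0P A0] := eqVneq A set0.
    by rewrite sup0 ltW.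
  apply: ge_sup => // _ [s [s0 srho ->]]; rewrite sqrtE.
  exact: (unbiased_guess_le u_basis lE m_unbiased s0 srho).
have HminE : Hmin rho (basis_measurement m) =
    - log2 (d%:R^-1 * retr (mxsqrt rho) ^+ 2) by rewrite /Hmin PguessE.
have HvNE : HvN rho (basis_measurement m) Psi = log2 d%:R - vn_entropy rho.
  rewrite (HvN_pinching Psi_pur mP) basis_measurement_tr.
  (* The pinched state is maximally mixed, since the [l k] sum to 1. *)
  rewrite (@pinching_basis_const _ _ _ _ (d%:R^-1)%:C).
  - rewrite trfun_scalar ?mul0r // mulrA divff ?gt_eqF // mul1r.
    by rewrite /log2 lnV ?posrE // mulNr opprK.
  - exact: orthonormal_conjv.
  - move=> i; rewrite inner_conjv.
    by rewrite (unbiased_expectation u_basis lE m_unbiased) l1 mulr1.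
have HmaxE : Hmax rho (basis_measurement m) Psi =
    log2 (d%:R * l k).
  congr log2; apply/eqP; rewrite eq_le; apply/andP; split.
    have [S SP SE] := sum_fidelity_unbiased u_basis lE Psi_pur m_basis
      m_unbiased d0 lk.
    apply: ge_sup; first by exists (d%:R * l k), S.
    move=> _ [T TP ->].
    exact: (sum_fidelity_le u_basis lE Psi_pur mP TP (ltW lk) lmax).
  have [S SP SE] := sum_fidelity_unbiased u_basis lE Psi_pur m_basis
    m_unbiased d0 lk.
  apply: ub_le_sup; last by exists S.
  exists (d%:R * l k) => _ [T TP ->].
  exact: (sum_fidelity_le u_basis lE Psi_pur mP TP (ltW lk) lmax).
split; [exact: mP| |split; [exact: HminE|exact: HvNE|]]; last first.
  by rewrite HmaxE lmaxE log2M.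
move=> n N NP; have NTP := projective_measurement_tr NP; split.
(* The lower bound on every guessing probability is the value attained by [m]. *)
- by rewrite HminE /Hmin lerN2 ler_log2 // Pguess_ge.
- rewrite HvNE (HvN_pinching Psi_pur NP) lerD2r.
  apply: vn_entropy_le => [||]; first exact: d0.
    apply: (pinching_psd NTP); rewrite -(steering_gram Psi_pur).
    exact: psd_gram.
  by rewrite /retr (trace_pinching NTP) mxtrace_tr rho1.
- rewrite HmaxE /Hmax; apply: ler_log2_ge1 => //.
  set A := (X in sup X); have [->|/set0P A0] := eqVneq A set0.
    by rewrite sup0 (le_trans ler01).
  apply: ge_sup => // _ [T TP ->].
  exact: (sum_fidelity_le u_basis lE Psi_pur NP TP (ltW lk) lmax).
Qed.
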